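(* For every integer $n\ge 0$, one has $$R_n\ge \frac{1}{12}\,9^n .$$
   Context: For an integer $n\ge 0$, let $\mathcal{Q}(n)=\{(x,y)\in\mathbb{Z}^2: 0\le x,\ 0\le y,\ x+y\le n\}$. Let $\mathcal{R}(n)$ be the set of all subsets $Y\subseteq\mathcal{Q}(n)$ such that: for any $(a,b),(c,d)\in Y$ with $\max(a,c)+\max(b,d)\le n+1$, we have $(\min(a,c),\min(b,d))\in Y$ and, additionally, $(\max(a,c),\max(b,d))\in Y$ as soon as $(\max(a,c),\max(b,d))\in\mathcal{Q}(n)$. Put $R_n=|\mathcal{R}(n)|$. *)

(* Defs.v *)
From mathcomp Require Import all_boot all_order all_algebra.

Set Implicit Arguments.
Unset Strict Implicit.
Unset Printing Implicit Defensive.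

(* Q(n) lies in the box [0, n]^2, so its points are encoded as pairs in
   'I_n.+1 * 'I_n.+1.  The box is closed under coordinatewise min and max. *)
Definition Q (n : nat) : {set 'I_n.+1 * 'I_n.+1} :=
  [set p : 'I_n.+1 * 'I_n.+1 | p.1 + p.2 <= n].

Definition pmin (n : nat) (p q : 'I_n.+1 * 'I_n.+1) : 'I_n.+1 * 'I_n.+1 :=
  (Order.min p.1 q.1, Order.min p.2 q.2).

Definition pmax (n : nat) (p q : 'I_n.+1 * 'I_n.+1) : 'I_n.+1 * 'I_n.+1 :=
  (Order.max p.1 q.1, Order.max p.2 q.2).

(* The threshold is n + 1, not n: when the maximum lies on the line
   x + y = n + 1, just outside Q(n), only the minimum is required to be in Y. *)
Definition RR (n : nat) : {set {set 'I_n.+1 * 'I_n.+1}} :=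
  [set Y : {set 'I_n.+1 * 'I_n.+1} |
    (Y \subset Q n) &&
    [forall p in Y, forall q in Y,
       ((pmax p q).1 + (pmax p q).2 <= n.+1) ==>
       ((pmin p q \in Y) && ((pmax p q \in Q n) ==> (pmax p q \in Y)))]].

(* Main.v *)
Require Import Defs.
From HB Require Import structures.
From Stdlib Require Import NArith.
From mathcomp Require Import all_boot all_order all_algebra zify ring.

Set Implicit Arguments.
Unset Strict Implicit.
Unset Printing Implicit Defensive.

(** Read a point [(a, b)] of [Q n] as an edge from [a] to [n + 1 - b]: the
    members of [RR n] become the relations on the vertices [0 .. n+1], contained
    in [<], such that two edges [(i, j)] and [(k, l)] with [i < k <= j < l] force
    the edge [(i, l)], and also the edge [(k, j)] when [k < j].  Delete the vertex
    0 and cut such a relation just before the last connected block [B] of what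
    remains.  The part [A] on the left of the cut, 0 included, is an arbitrary
    relation of the same kind, and the targets of 0 in [B] are the last [c]
    elements of the list made of the first vertex of [B] and its targets, for an
    arbitrary [c].  So the relations are coded by binary trees, and the numbers of
    relations with given number of vertices and given degree of 0 obey a
    convolution recursion.  Their growth rate exceeds 9, but around [n = 13] the
    bound [9^n / 12] is within 3 percent of the total.  Hence the
    recursion is evaluated up to 26 vertices, and from there on one propagates a
    lower bound [9^m * v], with a fixed vector [v] indexed by the degree of 0, by
    keeping only the terms in which one of the two parts has at most 8 vertices. *)

(** * Codes and their relations *)

(* In [Node A c B], the vertices of [A] come first and [c] is the number of
   targets of the vertex 0 in [B]. *)
Inductive code := Leaf | Node of code & nat & code.

Fixpoint code_eqb (x y : code) : bool :=
  match x, y with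
  | Leaf, Leaf => true
  | Node A c B, Node A' c' B' => [&& code_eqb A A', c == c' & code_eqb B B']
  | _, _ => false
  end.

Lemma code_eqP : Equality.axiom code_eqb.
Proof.
elim=> [|A IHA c B IHB] [|A' c' B'] /=; try by constructor.
by apply: (iffP and3P) => [[/IHA-> /eqP-> /IHB->]|[<- <- <-]];
  last by split; [apply/IHA|apply/eqP|apply/IHB].
Qed.

HB.instance Definition _ := hasDecEq.Build code code_eqP.

Fixpoint nverts (x : code) : nat :=
  if x is Node A _ B then nverts A + nverts B else 1.

Definition final (c : nat) (s : seq nat) := drop (size s - c) s.

Fixpoint nbrs (x : code) : seq nat :=
  if x is Node A c B then
    nbrs A ++ [seq nverts A + j | j <- final c (0 :: nbrs B)]
  else [::].

(** Only the vertex 0 has edges across the cut: a nonzero vertex of [A] has none into [B]. *)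
Fixpoint edge (x : code) (i j : nat) : bool :=
  if x is Node A c B then
    if i == 0 then j \in nbrs x
    else if i < nverts A then edge A i j
    else (nverts A <= j) && edge B (i - nverts A) (j - nverts A)
  else false.

(* For valid codes: the relation has an edge from the first to the last vertex,
   or there is only one vertex. *)
Definition is_tree (x : code) := if x is Node _ c _ then 0 < c else true.

Fixpoint valid (x : code) : bool :=
  if x is Node A c B then
    [&& valid A, valid B, is_tree B & c <= (size (nbrs B)).+1]
  else true.

Lemma nverts_gt0 x : 0 < nverts x.
Proof. by elim: x => //= A ? _ B IH; rewrite addn_gt0 IH orbT. Qed.

Lemma edge0 x j : edge x 0 j = (j \in nbrs x).
Proof. by case: x. Qed.

Lemma mem_final c s x : x \in final c s -> x \in s.
Proof. exact: mem_drop. Qed.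

Lemma size_final c s : c <= size s -> size (final c s) = c.
Proof. by move=> h; rewrite size_drop subKn. Qed.

(** A suffix of an increasing list is an upper set. *)
Lemma final_up c s x y : sorted ltn s ->
  x \in final c s -> y \in s -> x < y -> y \in final c s.
Proof.
move=> ss xs ys xy; move: ys; rewrite -{1}(cat_take_drop (size s - c) s) mem_cat.
case/orP=> // yt; move: ss; rewrite -{1}(cat_take_drop (size s - c) s).
rewrite sorted_pairwise; last exact: ltn_trans.
rewrite pairwise_cat => /and3P[/allrelP /(_ _ _ yt xs)]; lia.
Qed.

Lemma nbrs_bound x j : j \in nbrs x -> 0 < j < nverts x.
Proof.
elim: x j => //= A IHA c B IHB j; rewrite mem_cat => /orP[/IHA|/mapP[k /mem_final]].
  lia.
have := nverts_gt0 A; have := nverts_gt0 B.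
rewrite inE => ? ? /orP[/eqP-> ->|/IHB ? ->]; lia.
Qed.

Lemma nbrs_sorted x : sorted ltn (nbrs x).
Proof.
have lt_tr := ltn_trans.
elim: x => //= A IHA c B IHB; rewrite sorted_pairwise // pairwise_cat -!sorted_pairwise //.
rewrite IHA /=; apply/andP; split.
  by apply/allrelP => i j /nbrs_bound ? /mapP[k _ ->]; lia.
rewrite sorted_map; apply: (@sub_sorted _ ltn); first by move=> i j /=; lia.
apply: drop_sorted; rewrite /= path_min_sorted //.
by apply/allP => i /nbrs_bound; lia.
Qed.

Lemma nbrs0_sorted x : sorted ltn (0 :: nbrs x).
Proof.
rewrite /= path_min_sorted ?nbrs_sorted //.
by apply/allP => i /nbrs_bound; lia.
Qed.

Lemma edge_bound x i j : edge x i j -> i < j < nverts x.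
Proof.
elim: x i j => // A IHA c B IHB i j.
case: (posnP i) => [->|i0]; first by rewrite edge0 => /nbrs_bound.
rewrite [edge _ _ _]/= eqn0Ngt i0 /=.
by case: ltnP => [_ /IHA|? /andP[? /IHB]]; lia.
Qed.

(** The edges [(i, l)] and [(k, j)] are the minimum and the maximum of two incomparable points; for
    [k = j] the maximum is on the line [x + y = n + 1]. *)
Definition crossing_closed (e : rel nat) := forall i j k l,
  e i j -> e k l -> i < k -> k <= j -> j < l -> e i l /\ (k < j -> e k j).

(** Induction on the code: two crossing edges lie in the same part unless [i = 0] and [k] is in
    [B]. *)
Lemma edge_closed x : crossing_closed (edge x).
Proof.
elim: x => // A IHA c B IHB i j k l.
have p0 := nverts_gt0 A; set p := nverts A in p0 *.
case: (posnP i) => [->|i0].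
  rewrite !edge0 [nbrs _]/= -/p => jx ekl k0 kj jl.
  move: ekl; rewrite [edge _ k l]/= [edge _ k j]/= -/p eqn0Ngt k0 /=.
  case: (ltnP k p) => [kp ekl|pk /andP[pl ekl]].
    have lp : l < p by have := edge_bound ekl; lia.
    have jA : edge A 0 j.
      move: jx; rewrite edge0 mem_cat => /orP[//|/mapP[t _ jt]]; lia.
    by case: (IHA _ _ _ _ jA ekl k0 kj jl) => a b; rewrite mem_cat -edge0 a.
  have /mapP[j' j'D jE] : j \in [seq p + t | t <- final c (0 :: nbrs B)].
    by move: jx; rewrite mem_cat => /orP[/nbrs_bound|//]; lia.
  have lE : l = p + (l - p) by lia.
  have j'N : 0 < j' -> edge B 0 j'.
    by move/mem_final: j'D; rewrite inE edge0 => /orP[/eqP->|//].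
  (* The suffix containing [j'] is an upper set, so it suffices that [l - p] be a target of the
     first vertex of [B]. *)
  have key : l - p \in nbrs B -> l \in nbrs A ++ [seq p + t | t <- final c (0 :: nbrs B)].
    move=> lB; rewrite mem_cat lE map_f ?orbT //.
    apply: (final_up (nbrs0_sorted B) j'D); first by rewrite inE lB orbT.
    lia.
  have jpE : j - p = j' by lia.
  have pj : p <= j by lia.
  rewrite pj jpE /=.
  case: (posnP (k - p)) => [kp0|kp0].
    rewrite kp0 edge0 in ekl; split; first exact: key.
    by rewrite kp0 => ?; apply: j'N; lia.
  have [||||a b] := IHB 0 j' (k - p) (l - p) _ ekl; rewrite ?edge0 //; try lia.
    by rewrite -edge0; apply: j'N; lia.
  by rewrite edge0 in a; split; [exact: key|move=> ?; apply: b; lia].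
rewrite /= -/p [i == 0]eqn0Ngt i0 /= => eij ekl ik kj jl.
have k0 : (k == 0) = false by lia.
rewrite k0 in ekl *.
case: (ltnP i p) eij => [ip eij|pi /andP[pj eij]].
  have kp : k < p by have := edge_bound eij; lia.
  by rewrite kp in ekl *; apply: IHA ekl _ _ _.
have kp : (k < p) = false by lia.
rewrite kp in ekl *; case/andP: ekl => pl ekl.
have [||| a b] := IHB _ _ _ _ eij ekl; lia.
Qed.

Lemma last_final c x s : 0 < c -> last x (final c (x :: s)) = last x s.
Proof.
move=> c0; rewrite /final; set d := _ - c.
have dlt : d < size (x :: s) by rewrite /d /=; lia.
have := cat_take_drop d (x :: s); case E : (drop d (x :: s)) => [|y r].
  by move/(congr1 size): E; rewrite size_drop /= in dlt *; lia.
by move/(congr1 (last x)) => /=; rewrite last_cat.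
Qed.

(** For [0 < c] the suffix contains the last element of [0 :: nbrs B], by induction the last vertex
    of [B]. *)
Lemma last_nbrs x : valid x -> is_tree x -> last 0 (nbrs x) = (nverts x).-1.
Proof.
elim: x => // A IHA c B IHB /= /and4P[vA vB tB cB] c0.
have := IHB vB tB => lB; rewrite last_cat.
have := last_final 0 (nbrs B) c0; rewrite lB.
have : size (final c (0 :: nbrs B)) = c by rewrite size_final.
case: (final _ _) => [|y r]; first by move=> /= E; rewrite -E in c0.
by move=> _ /= E; rewrite last_map E; have := nverts_gt0 B; lia.
Qed.

Lemma tree_edge x : valid x -> is_tree x -> 1 < nverts x ->
  edge x 0 (nverts x).-1.
Proof.
move=> vx tx n1; rewrite edge0; have := last_nbrs vx tx.
by have := mem_last 0 (nbrs x); rewrite inE => /orP[/eqP->|h <- //]; lia.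
Qed.

(** * Recovering a code from its relation *)

Lemma edge_Node_left A c B i j : edge A i j = (edge (Node A c B) i j) && (j < nverts A).
Proof.
have p0 := nverts_gt0 A.
case: (posnP i) => [->|i0].
  rewrite !edge0 /= mem_cat; apply/idP/andP => [jA|[/orP[//|/mapP[k _ ->]]]].
    by rewrite jA; have := nbrs_bound jA; lia.
  lia.
rewrite /= [i == 0]eqn0Ngt i0 /=; case: ltnP => ip.
  by apply/idP/andP => [h|[]//]; split=> //; have := edge_bound h; lia.
by apply/idP/andP => [h|[/andP[? /edge_bound]]]; [have := edge_bound h|]; lia.
Qed.

Lemma edge_Node_right A c B i j :
  edge B i j = edge (Node A c B) (nverts A + i) (nverts A + j).
Proof.
have p0 := nverts_gt0 A; rewrite /= addn_eq0 eqn0Ngt p0 /=.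
by rewrite ltnNge leq_addr /= leq_addr !addKn.
Qed.

(* The first component is recovered from the relation: the second one is spanned
   by an edge joining its first vertex to the last vertex, and no nonzero vertex
   before it is joined to the last vertex. *)
Lemma split_leq A c B A' c' B' :
  valid (Node A c B) -> valid (Node A' c' B') ->
  nverts (Node A c B) = nverts (Node A' c' B') ->
  edge (Node A c B) =2 edge (Node A' c' B') -> nverts A <= nverts A'.
Proof.
move=> /= /and4P[vA vB tB cB] /and4P[vA' vB' tB' cB'] eqn eqe.
rewrite leqNgt; apply/negP => lt.
have p0 := nverts_gt0 A'; have b0 := nverts_gt0 B; have b0' := nverts_gt0 B'.
have := eqe (nverts A') (nverts A' + (nverts B').-1).
rewrite -[X in _ = edge (Node _ _ _) X _]addn0 -edge_Node_right.
rewrite tree_edge //; last by lia.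
rewrite /= [_ == 0]eqn0Ngt p0 lt => /edge_bound; lia.
Qed.

(** [split_leq] used both ways fixes the cut, [A] and [B] are the restrictions to its two sides, and
    the degree of 0 then gives [c]. *)
Lemma edge_inj x y : valid x -> valid y -> nverts x = nverts y ->
  edge x =2 edge y -> x = y.
Proof.
elim: x y => [|A IHA c B IHB] [|A' c' B'] //; first 2 last.
- move=> vx vy eqn eqe.
  have eqA : nverts A = nverts A'.
    apply/eqP; rewrite eqn_leq (split_leq vx vy) //=.
    by rewrite (split_leq vy vx) // => i j; rewrite eqe.
  have eqB : nverts B = nverts B' by move: eqn => /=; lia.
  have [/and4P[vA vB _ cB] /and4P[vA' vB' _ cB']] := conj vx vy.
  have AE : A = A'.
    by apply: IHA => // i j; rewrite (edge_Node_left A c B) eqe eqA -edge_Node_left.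
  have BE : B = B'.
    apply: IHB => // i j.
    by rewrite (edge_Node_right A c B) eqe eqA -edge_Node_right.
  rewrite -{}AE -{}BE in vy eqe cB' *; congr Node.
  have /(congr1 size) : nbrs (Node A c B) = nbrs (Node A c' B).
    apply: (irr_sorted_eq ltn_trans ltnn) => [||j]; rewrite ?nbrs_sorted //.
    by rewrite -!edge0.
  by rewrite /= !size_cat !size_map !size_final //; lia.
- by have := nverts_gt0 A'; have := nverts_gt0 B' => /=; lia.
- by have := nverts_gt0 A; have := nverts_gt0 B => /=; lia.
Qed.

(** * Realization in [RR n] *)

Definition realize (n : nat) (x : code) : {set 'I_n.+1 * 'I_n.+1} :=
  [set q : 'I_n.+1 * 'I_n.+1 | edge x q.1 (n.+1 - q.2)].

Lemma realize_RR n x : nverts x = n.+2 -> realize n x \in RR n.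
Proof.
move=> nx; rewrite inE; apply/andP; split.
  by apply/subsetP => q; rewrite !inE => /edge_bound; have := ltn_ord q.2; lia.
apply/forall_inP => -[a b] /[!inE] /= ab; apply/forall_inP => -[c d] /[!inE] /= cd.
have [aE bE] := (edge_bound ab, edge_bound cd).
have [bn dn] := (ltn_ord b, ltn_ord d).
apply/implyP; rewrite /pmin /pmax /=.
case: (Order.TotalTheory.leP a c); rewrite ?leEord ?ltEord => ac;
  case: (Order.TotalTheory.leP b d); rewrite ?leEord ?ltEord => bd /=;
  rewrite ?ab ?cd ?implybT //=.
(* Up to equal coordinates, what remains is an incomparable pair, that is, two crossing edges. *)
- move=> h; case: (ltngtP a c) ac => // [ac _|/val_inj E _];
    last by rewrite -E in cd *; rewrite cd ab implybT.
  have [||-> e2] := edge_closed ab cd ac; lia.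
- move=> h; case: (ltngtP b d) bd => // [bd _|/val_inj E _];
    last by rewrite -E in cd *; rewrite cd ab implybT.
  have [||-> e2] := edge_closed cd ab ac; lia.
Qed.

Lemma realize_edge n x i j : nverts x = n.+2 ->
  edge x i j = [&& i < j, j < n.+2 & (inord i, inord (n.+1 - j)) \in realize n x].
Proof.
move=> nx; case: (boolP (i < j)) => /= ij; last first.
  by apply/idP => /edge_bound; lia.
case: (boolP (j < n.+2)) => /= jn; last by apply/idP => /edge_bound; lia.
by rewrite inE /= !inordK; [congr edge| |]; lia.
Qed.

Lemma realize_inj n x y : valid x -> valid y ->
  nverts x = n.+2 -> nverts y = n.+2 -> realize n x = realize n y -> x = y.
Proof.
move=> vx vy nx ny eqr; apply: edge_inj => //; first by rewrite nx.
by move=> i j; rewrite (realize_edge i j nx) (realize_edge i j ny) eqr.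
Qed.

(** * Counting codes *)

Definition labelled_trees (s : seq code) : seq (code * nat) :=
  [seq (B, c) | B <- filter is_tree s, c <- iota 0 (size (nbrs B)).+2].

(** [n] bounds the height, a leaf having height 1. The height is at most the number of leaves, which
    is [nverts]. *)
Fixpoint codes (n : nat) : seq code :=
  if n is k.+1 then
    Leaf :: [seq Node A y.2 y.1 | A <- codes k,
                                  y <- labelled_trees (codes k)]
  else [::].

Lemma codes_uniq n : uniq (codes n).
Proof.
elim: n => //= n IH; apply/andP; split.
  by apply/negP => /allpairsP[[A y] []].
apply: allpairs_uniq => //.
  apply: (@allpairs_uniq_dep _ (fun=> nat) _ (fun B c => (B, c))).
    by rewrite filter_uniq.
    by move=> *; rewrite iota_uniq.
  by move=> [? ?] [? ?] _ _ [-> ->].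
by move=> [A [B c]] [A' [B' c']] _ _ [-> -> ->].
Qed.

Lemma codes_valid n x : x \in codes n -> valid x.
Proof.
elim: n x => //= n IH x; rewrite inE => /orP[/eqP->//|].
case/allpairsP => -[A y] /= [/IH vA /allpairsPdep[B [c [+ + ->]]] ->] /=.
by rewrite mem_filter mem_iota vA => /andP[-> /IH->].
Qed.

Lemma mem_codes n x : valid x -> nverts x <= n -> x \in codes n.
Proof.
elim: n x => [|n IH] x; first by have := nverts_gt0 x; lia.
case: x => [|A c B] //= /and4P[vA vB tB cB] le; rewrite inE /=.
have [pA pB] := (nverts_gt0 A, nverts_gt0 B).
apply/allpairsP; exists (A, (B, c)); split=> //=; first by apply: IH => //; lia.
apply/allpairsPdep; exists B, c; rewrite mem_filter tB mem_iota; split=> //.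
by apply: IH => //; lia.
Qed.

Lemma count_codes (Q : pred code) m k : (forall x, Q x -> nverts x = m) -> m <= k ->
  count Q (codes k) = count Q (codes m).
Proof.
move=> Qm mk; rewrite -!size_filter; apply/perm_size/uniq_perm;
  rewrite ?filter_uniq ?codes_uniq //.
move=> x; rewrite !mem_filter; case: (boolP (Q x)) => //= /Qm xm.
by apply/idP/idP => /codes_valid vx; rewrite mem_codes ?xm.
Qed.

Definition degree x := size (nbrs x).

Lemma degree_Node A c B : valid (Node A c B) -> degree (Node A c B) = degree A + c.
Proof. by case/and4P=> _ _ _ cB; rewrite /degree /= size_cat size_map size_final. Qed.

Definition ncodes (b : bool) (m s : nat) : nat :=
  count (fun x => [&& nverts x == m, degree x == s & b ==> is_tree x]) (codes m).

Definition ntrees (m c : nat) : nat :=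
  count (fun x => [&& nverts x == m, is_tree x & c <= (degree x).+1]) (codes m).

Lemma sum_single (r : seq nat) (k : nat) (f : nat -> nat) : uniq r ->
  {in r, forall i, i != k -> f i = 0} -> \sum_(i <- r) f i = (k \in r) * f k.
Proof.
move=> ur f0; case: (boolP (k \in r)) => kr.
  by rewrite (bigD1_seq k) //= big_seq_cond big1 ?addn0 ?mul1n // => i /andP[]; apply: f0.
by rewrite big_seq big1 // => i ir; apply: f0 => //; apply: contraNneq kr => <-.
Qed.

(** [Node A c B] belongs to the term where [a] is the size of [A], and its degree is that of [A]
    plus [c]. Trees need [0 < c], whence the lower limit [b]. *)
Lemma ncodes_rec (b : bool) m s : 1 < m ->
  \sum_(1 <= a < m) \sum_(b <= c < s.+1) ncodes false a (s - c) * ntrees (m - a) c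
    <= ncodes b m s.
Proof.
case: m => // m m0.
(* As a sum of indicators over lists independent of [a] and [c], each product can be exchanged with
   the outer sums. *)
have E a c : 1 <= a < m.+1 ->
    ncodes false a (s - c) * ntrees (m.+1 - a) c =
    \sum_(A <- codes m) \sum_(B <- filter is_tree (codes m))
      [&& nverts A == a, degree A == s - c, nverts B == m.+1 - a & c <= (degree B).+1].
  move=> am; rewrite /ncodes /ntrees.
  rewrite -(@count_codes _ a m); [|by move=> x /= /and3P[/eqP]|lia].
  rewrite -(@count_codes _ (m.+1 - a) m); [|by move=> x /= /and3P[/eqP]|lia].
  rewrite -!sum1_count big_mkcond [X in _ * X]big_mkcond big_distrl /=.
  apply: eq_bigr => A _; rewrite big_distrr big_filter [RHS]big_mkcond /=.
  apply: eq_bigr => B _; rewrite andbT.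
  by case: (_ A == _); case: (_ A == _); case: (_ B == _); case: (is_tree B); case: (c <= _).
have {E} -> : \sum_(1 <= a < m.+1) \sum_(b <= c < s.+1)
      ncodes false a (s - c) * ntrees (m.+1 - a) c =
    \sum_(A <- codes m) \sum_(B <- filter is_tree (codes m))
      \sum_(1 <= a < m.+1) \sum_(b <= c < s.+1)
      [&& nverts A == a, degree A == s - c, nverts B == m.+1 - a & c <= (degree B).+1].
  under eq_big_nat => a am do under eq_bigr => c _ do rewrite E //.
  under eq_bigr => a _ do rewrite exchange_big.
  rewrite exchange_big; apply: eq_bigr => A _.
  under eq_bigr => a _ do rewrite exchange_big.
  by rewrite exchange_big.
rewrite /ncodes -sum1_count [leqRHS]big_mkcond [codes m.+1]/= big_cons.
apply: leq_trans (leq_addl _ _); rewrite big_allpairs_dep /=.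
rewrite big_seq [leqRHS]big_seq; apply: leq_sum => A /codes_valid vA.
rewrite big_allpairs_dep big_seq [leqRHS]big_seq; apply: leq_sum => B.
rewrite mem_filter => /andP[tB /codes_valid vB].
(* For given [A] and [B] at most one pair [(a, c)] contributes. *)
rewrite (sum_single (k := nverts A)) ?iota_uniq // => [|a _ aA]; last first.
  by rewrite big1 // => c _; rewrite eq_sym (negPf aA).
case: (boolP (nverts A \in _)); rewrite ?mul0n // mul1n mem_index_iota => nA.
under eq_bigr => c _ do rewrite eqxx /=.
rewrite (sum_single (k := s - degree A)) ?iota_uniq // => [|c]; last first.
  by rewrite mem_index_iota; case: eqP => // ? ? ?; lia.
set k := s - degree A; case: (boolP (k \in _)); rewrite ?mul0n // mul1n mem_index_iota => kr.
case: and3P => //= -[/eqP kA /eqP nB kB].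
have uB := iota_uniq 0 (size (nbrs B)).+2.
have kI : k \in iota 0 (size (nbrs B)).+2 by rewrite mem_iota.
rewrite (bigD1_seq k kI uB) /=.
have vx : valid (Node A k B) by rewrite /= vA vB tB.
rewrite (degree_Node vx) nB (_ : nverts A + _ == _); last by lia.
rewrite (_ : degree A + k == s); last by lia.
by rewrite (_ : b ==> _) //; lia.
Qed.

(** The label [c] fits exactly the trees of degree at least [c.-1]; cutting the degrees at [S] loses
    some of them. *)
Lemma ntrees_sum m c S :
  \sum_(c.-1 <= s < S) ncodes true m s <= ntrees m c.
Proof.
rewrite /ncodes /ntrees; under eq_bigr => s _ do rewrite -sum1_count big_mkcond.
rewrite exchange_big -sum1_count [leqRHS]big_mkcond; apply: leq_sum => x _ /=.
case: (boolP (nverts x == m)) => /= _; last by rewrite big1.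
case: (boolP (is_tree x)) => /= _; last by rewrite big1 // => s _; rewrite andbF.
rewrite (sum_single (k := degree x)) ?iota_uniq // => [|i _ ix]; last first.
  by rewrite andbT eq_sym (negPf ix).
rewrite eqxx mem_index_iota; case: (leqP c _) => /=; last lia.
by rewrite muln1; case: (_ && _).
Qed.

Lemma sum_ncodes_RR n S : \sum_(s < S) ncodes false n.+2 s <= #|RR n|.
Proof.
pose L := [seq x <- codes n.+2 | nverts x == n.+2].
have LP x : x \in L -> valid x /\ nverts x = n.+2.
  by rewrite mem_filter => /andP[/eqP-> /codes_valid->].
apply: (@leq_trans (size L)).
  rewrite size_filter /ncodes.
  under eq_bigr => s _ do rewrite -sum1_count big_mkcond.
  rewrite exchange_big -sum1_count [leqRHS]big_mkcond; apply: leq_sum => x _ /=.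
  case: (_ == n.+2); last by rewrite big1.
  rewrite -(big_mkord xpredT (fun s => if (degree x == s) && true then 1 else 0)).
  rewrite (sum_single (k := degree x)) ?iota_uniq // => [|i _ ix]; last first.
    by rewrite andbT eq_sym (negPf ix).
  by rewrite eqxx muln1; case: (_ \in _).
rewrite -(size_map (realize n)) cardE; apply: uniq_leq_size.
  rewrite map_inj_in_uniq ?filter_uniq ?codes_uniq // => x y /LP[vx nx] /LP[vy ny].
  exact: realize_inj.
by move=> _ /mapP[x /LP[_ nx] ->]; rewrite mem_enum realize_RR.
Qed.

(** The range of [c] is a parameter because the terms with [0 < c] serve both for trees and for all
    codes. *)
Definition psum (m : nat) (r : seq nat) (s : nat) : nat :=
  \sum_(1 <= a < m) \sum_(c <- r) ncodes false a (s - c) * ntrees (m - a) c.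

Lemma psum_ntrue m s : 1 < m -> psum m (iota 1 s) s <= ncodes true m s.
Proof. by move=> m1; have := ncodes_rec true s m1; rewrite /index_iota subSS subn0. Qed.

Lemma psum_nfalse m s : 1 < m ->
  psum m (iota 1 s) s + psum m [:: 0] s <= ncodes false m s.
Proof.
move=> m1; apply: leq_trans (ncodes_rec false s m1); rewrite addnC -big_split /=.
by apply: leq_sum => a _; rewrite big_seq1 /index_iota subn0 big_cons subn0.
Qed.

(** * Numerical evaluation *)

Notation "s `[ i ]" := (nth 0%num s i) (at level 2, format "s `[ i ]").

Notation row := (seq N * seq N)%type.

Definition sumN (T : Type) (r : seq T) (f : T -> N) : N :=
  foldr (fun i acc => N.add (f i) acc) 0%num r.

Definition conv (r : seq nat) (l : seq row) (s : nat) : N :=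
  sumN l (fun PG => sumN r (fun c => N.mul PG.1`[s - c] PG.2`[c])).

(* Degrees [>= 11] are discarded, which only lowers the computed values. *)
Definition width := 11.

Definition tails (t : seq N) : seq N :=
  mkseq (fun c => sumN (index_iota c.-1 width) (nth 0%num t)) width.

(** Reversal pairs codes of size [a] with trees of size [m - a], where [m] is [size h] plus 1. *)
Definition next_row (h : seq row) : row :=
  let l := zip (unzip1 h) (rev (unzip2 h)) in
  let t := mkseq (fun s => conv (iota 1 s) l s) width in
  (mkseq (fun s => N.add t`[s] (conv [:: 0] l s)) width, tails t).

(* The entry of index [i] of [table m] bounds the codes with [i.+1] vertices. *)
Definition table (m : nat) : seq row :=
  iter m (fun h => rcons h (next_row h)) [:: ([:: 1%num], [:: 1%num; 1%num])].

Lemma to_nat_sumN (T : Type) (r : seq T) (f : T -> N) :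
  N.to_nat (sumN r f) = \sum_(i <- r) N.to_nat (f i).
Proof.
elim: r => [|i r IH]; first by rewrite big_nil.
by rewrite big_cons -IH /= N2Nat.inj_add.
Qed.

Lemma to_nat_conv r l s : N.to_nat (conv r l s) =
  \sum_(PG <- l) \sum_(c <- r) N.to_nat PG.1`[s - c] * N.to_nat PG.2`[c].
Proof.
rewrite to_nat_sumN; apply: eq_bigr => PG _; rewrite to_nat_sumN.
by apply: eq_bigr => c _; rewrite N2Nat.inj_mul.
Qed.

Lemma nth_mkseqN (f : nat -> N) k i :
  N.to_nat (mkseq f k)`[i] = (i < k) * N.to_nat (f i).
Proof.
case: ltnP => ik; first by rewrite nth_mkseq // mul1n.
by rewrite nth_default ?size_mkseq.
Qed.

(** The factors are 1 for the table, and [9 ^ n] and [d] for the propagated vector. *)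
Lemma tails_ntrees t m (u v : nat) :
  (forall s, u * N.to_nat t`[s] <= v * ncodes true m s) ->
  forall c, u * N.to_nat (tails t)`[c] <= v * ntrees m c.
Proof.
move=> tP c; rewrite nth_mkseqN to_nat_sumN.
apply: (@leq_trans (v * \sum_(c.-1 <= s < width) ncodes true m s)); last first.
  by rewrite leq_mul2l ntrees_sum orbT.
case: (c < width); rewrite ?muln0 // mul1n !big_distrr /=.
by apply: leq_sum => s _; apply: tP.
Qed.

Definition row_le (m : nat) (PG : row) := forall i,
  N.to_nat PG.1`[i] <= ncodes false m i /\ N.to_nat PG.2`[i] <= ntrees m i.

Definition table_le (h : seq row) :=
  forall i, i < size h -> row_le i.+1 (nth ([::], [::]) h i).

Lemma next_row_le h : 0 < size h -> table_le h -> row_le (size h).+1 (next_row h).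
Proof.
move=> h0 hP; rewrite /next_row; set l := zip _ _.
set t := mkseq (fun s => conv (iota 1 s) l s) width.
have sl : size l = size h by rewrite size_zip size_rev !size_map minnn.
have convP r s : N.to_nat (conv r l s) <= psum (size h).+1 r s.
  rewrite to_nat_conv (big_nth ([::], [::])) sl /psum big_add1 /=.
  rewrite !big_nat; apply: leq_sum => i /andP[_ ih]; apply: leq_sum => c _.
  rewrite nth_zip ?size_rev ?size_map //= nth_rev size_map //.
  rewrite (nth_map ([::], [::])) // (nth_map ([::], [::])); last by lia.
  have [h1 _] := hP i ih (s - c).
  have [|_ h2] := hP (size h - i.+1) _ c; first by lia.
  by rewrite leq_mul // (leq_trans h2) // (_ : _.+1 = (size h).+1 - i.+1) //; lia.
have tP s : N.to_nat t`[s] <= psum (size h).+1 (iota 1 s) s.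
  by rewrite nth_mkseqN; case: (s < _) => //; rewrite mul1n convP.
move=> i; split.
  apply: leq_trans (psum_nfalse _ _); last by lia.
  rewrite nth_mkseqN N2Nat.inj_add; case: (i < _) => //; rewrite mul1n.
  by rewrite leq_add ?tP ?convP.
rewrite -[leqLHS]mul1n -[leqRHS]mul1n; apply: tails_ntrees => s.
by rewrite !mul1n; apply: leq_trans (tP s) (psum_ntrue _ _); lia.
Qed.

Lemma table_size m : size (table m) = m.+1.
Proof. by elim: m => //= m IH; rewrite size_rcons IH. Qed.

Lemma tableP m : table_le (table m).
Proof.
elim: m => [|m IH] i.
  by case: i => // _ [|[|i]] //=; rewrite !nth_nil.
rewrite /= size_rcons nth_rcons ltnS leq_eqVlt => /orP[/eqP->|ih].
  by rewrite ltnn eqxx; apply: next_row_le; rewrite ?table_size.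
by rewrite ih; apply: IH.
Qed.

(* [sub_p] and [sub_t] are the minima over [19 <= m <= 26], multiplied by [den]
   and rounded down, of the tabulated numbers of all codes, resp. trees, with
   [m] vertices divided by [9 ^ m].  The factor 972 of [den] is [12 * 9 ^ 2]. *)
Definition sub_t : seq N :=
  map N.of_nat [:: 0; 1154; 1396; 1351; 1175; 947; 715; 505; 332; 200; 109].
Definition sub_p : seq N :=
  map N.of_nat [:: 1154; 1523; 1686; 1597; 1376; 1103; 828; 581; 380; 228; 123].
Definition den : N := 9720000%num.

Definition pow9 (m : nat) : N := N.pow 9 (N.of_nat m).

(** The left part, then the right part, has [i + 1 <= 8] vertices; the fixed vector bounds the other
    one. The factor [9 ^ (7 - i)] is [9 ^ 8 / 9 ^ (i + 1)]. *)
Definition scaled_rows (h : seq row) : seq row :=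
  [seq (map (N.mul (pow9 (7 - i))) (nth ([::], [::]) h i).1, tails sub_t) | i <- iota 0 8] ++
  [seq (sub_p, map (N.mul (pow9 (7 - i))) (nth ([::], [::]) h i).2) | i <- iota 0 8].

Definition step_check (h : seq row) : bool :=
  let l := scaled_rows h in
  all (fun s => let x := conv (iota 1 s) l s in
    N.leb (N.mul (pow9 8) sub_t`[s]) x &&
    N.leb (N.mul (pow9 8) sub_p`[s]) (N.add x (conv [:: 0] l s))) (iota 0 width).

(** The final bound for 2 to 26 vertices, then the base case of the induction for 19 to 26: eight
    sizes, since a step looks back by eight. *)
Definition table_check (h : seq row) : bool :=
  all (fun i => N.leb (pow9 i.+1)
      (N.mul 972 (sumN (iota 0 width) (nth 0%num (nth ([::], [::]) h i).1))))
    (iota 1 25) &&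
  all (fun i => all (fun s =>
      N.leb (N.mul (pow9 i.+1) sub_p`[s]) (N.mul den (nth ([::], [::]) h i).1`[s]) &&
      N.leb (N.mul (pow9 i.+1) (tails sub_t)`[s]) (N.mul den (nth ([::], [::]) h i).2`[s]))
    (iota 0 width)) (iota 18 8).

(** The existential hides the table from later unfolding. *)
Lemma checked_table : exists h,
  [/\ size h = 26, table_le h, step_check h & table_check h].
Proof.
have st : step_check (table 25) by vm_compute.
have ta : table_check (table 25) by vm_compute.
exact: (ex_intro _ (table 25) (And4 (table_size 25) (@tableP 25) st ta)).
Qed.

(** * Propagation of the lower bound to all sizes *)

Definition sub_solution_at (d n : nat) := forall i,
  9 ^ n * N.to_nat sub_p`[i] <= d * ncodes false n i /\
  9 ^ n * N.to_nat (tails sub_t)`[i] <= d * ntrees n i.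

Lemma to_nat_pow9 m : N.to_nat (pow9 m) = 9 ^ m.
Proof.
rewrite /pow9; elim: m => // m IH.
by rewrite Nat2N.inj_succ N.pow_succ_r' N2Nat.inj_mul IH expnS.
Qed.

Lemma leb_to_nat a b : N.leb a b -> N.to_nat a <= N.to_nat b.
Proof. by move/N.leb_le; lia. Qed.

Lemma nth_scale k (p : seq N) i :
  N.to_nat (map (N.mul k) p)`[i] = N.to_nat k * N.to_nat p`[i].
Proof.
case: (ltnP i (size p)) => ip; first by rewrite (nth_map 0%num) // N2Nat.inj_mul.
by rewrite !nth_default ?size_map // muln0.
Qed.

Lemma leq_scaled_mul x y z w d P G p t :
  x * y = w * z -> P <= p -> z * G <= d * t -> x * (y * P * G) <= d * w * (p * t).
Proof.
move=> xy Pp Gt.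
have -> : x * (y * P * G) = w * (P * (z * G)).
  by transitivity (x * y * (P * G)); [|rewrite xy]; ring.
have -> : d * w * (p * t) = w * (p * (d * t)) by ring.
by rewrite leq_mul2l leq_mul ?orbT.
Qed.

Lemma sum_ends (F : nat -> nat) k n : 2 * k < n ->
  \sum_(0 <= i < k) F i.+1 + \sum_(0 <= i < k) F (n - i.+1) <= \sum_(1 <= a < n) F a.
Proof.
move=> kn; rewrite [leqRHS](big_cat_nat (n := k.+1)) //=; last by lia.
rewrite big_add1 leq_add2l [leqRHS](big_cat_nat (n := n - k)) /=; [|lia|lia].
apply: leq_trans (leq_addl _ _); rewrite [leqRHS]big_nat_rev /=.
rewrite -{1}[X in index_iota X n]add0n big_addn subKn; last by lia.
by rewrite !big_nat leq_sum // => i ik; rewrite (_ : n - k + n - _ = n - i.+1) //; lia.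
Qed.

(** By [16 < n] the terms with a small left part and those with a small right part are disjoint. *)
Lemma conv_scaled_rows d w h n r s : w = 9 ^ 8 -> 16 < n -> table_le h -> 8 <= size h ->
  (forall a, 0 < a <= 8 -> sub_solution_at d (n - a)) ->
  9 ^ n * N.to_nat (conv r (scaled_rows h) s) <= d * w * psum n r s.
Proof.
move=> wE n16 hP sh IH; rewrite to_nat_conv big_cat !big_map.
apply: leq_trans (leq_mul (leqnn _) (@sum_ends _ 8 n n16)).
rewrite -/(index_iota 0 8) [leqRHS]mulnDr [leqLHS]mulnDr.
have E i : i < 8 -> 9 ^ n * 9 ^ (7 - i) = w * 9 ^ (n - i.+1).
  by move=> i8; rewrite wE -!expnD; congr expn; lia.
apply: leq_add; rewrite !big_distrr !big_nat; apply: leq_sum => i /andP[_ i8];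
  rewrite !big_distrr; apply: leq_sum => c _; rewrite nth_scale to_nat_pow9.
  have [Pp _] := hP i (leq_trans i8 sh) (s - c); have [_ Gt] := IH i.+1 i8 c.
  exact: leq_scaled_mul (E _ i8) Pp Gt.
have [_ Gt] := hP i (leq_trans i8 sh) c; have [Pp _] := IH i.+1 i8 (s - c).
rewrite subKn; last by lia.
have := leq_scaled_mul (E _ i8) Gt Pp.
by rewrite (mulnC (_ * _) (N.to_nat sub_p`[_])) (mulnC (ntrees _ _)).
Qed.

Lemma sub_solution_base d h n : d = N.to_nat den -> size h = 26 -> table_le h ->
  table_check h -> 18 < n <= 26 -> sub_solution_at d n.
Proof.
move=> dE sh hP /andP[_ /allP chk] n18 i; case: n n18 => // n n18.
have [Pi Gi] := hP n (ltac:(lia) : n < size h) i.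
move: (chk n); rewrite mem_iota => /(_ n18) /allP /(_ i).
rewrite mem_iota; case: (ltnP i width) => iw; last first.
  by move=> _; rewrite nth_mkseqN ltnNge iw nth_default // !muln0.
move=> /(_ isT) /andP[/leb_to_nat + /leb_to_nat].
rewrite !N2Nat.inj_mul !to_nat_pow9 -dE => h1 h2.
by split; [apply: leq_trans h1 _|apply: leq_trans h2 _]; rewrite leq_mul2l ?Pi ?Gi orbT.
Qed.

(** Strong induction: beyond 26, the eight preceding sizes all exceed 18, and [step_check] gives
    back the same vector. *)
Lemma sub_solution_all d h n : d = N.to_nat den -> size h = 26 -> table_le h ->
  step_check h -> table_check h -> 18 < n -> sub_solution_at d n.
Proof.
move=> dE sh hP /allP st ta.
(* [w] and [d] stay abstract: their unary normal forms are huge. *)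
have [w wE] : exists w, w = 9 ^ 8 := ex_intro _ _ erefl.
elim/ltn_ind: n => n IH n18; case: (leqP n 26) => n26.
  by apply: (sub_solution_base dE sh hP ta); rewrite n18.
have conv_le r s : 9 ^ n * N.to_nat (conv r (scaled_rows h) s)
    <= d * w * psum n r s.
  apply: conv_scaled_rows; [done|lia|done|by rewrite sh|].
  by move=> a a8; apply: IH; lia.
have bound (t : nat) u q : w * N.to_nat u <= t ->
    9 ^ n * t <= d * w * q -> 9 ^ n * N.to_nat u <= d * q.
  move=> ut tq; rewrite -(leq_pmul2l (m := w)) ?wE ?expn_gt0 // -wE.
  rewrite mulnCA (leq_trans (leq_mul (leqnn _) ut)) // (leq_trans tq) //.
  by rewrite -mulnA mulnCA.
have tP s : 9 ^ n * N.to_nat sub_t`[s] <= d * ncodes true n s.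
  case: (ltnP s width) => sw; last by rewrite nth_default // muln0.
  have := st s; rewrite mem_iota => /(_ sw) /andP[/leb_to_nat + _].
  rewrite N2Nat.inj_mul to_nat_pow9 -wE => /bound; apply=> //.
  by apply: leq_trans (conv_le _ _) _; rewrite leq_mul2l psum_ntrue ?orbT //; lia.
move=> i; split; last exact: tails_ntrees.
case: (ltnP i width) => iw; last by rewrite nth_default // muln0.
have := st i; rewrite mem_iota => /(_ iw) /andP[_ /leb_to_nat].
rewrite N2Nat.inj_mul N2Nat.inj_add to_nat_pow9 -wE => /bound; apply=> //.
rewrite mulnDr; apply: leq_trans (leq_add (conv_le (iota 1 i) i) (conv_le [:: 0] i)) _.
by rewrite -mulnDr leq_mul2l psum_nfalse ?orbT //; lia.
Qed.

Lemma ncodes_lower n : 1 < n -> 9 ^ n <= 972 * \sum_(s < width) ncodes false n s.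
Proof.
have [h [sh hP st ta]] := checked_table.
move=> n1; case: (leqP n 26) => n26.
  case: n n1 n26 => // n n1 n26; have /andP[/allP /(_ n) + _] := ta.
  rewrite mem_iota => /(_ (ltac:(lia) : 1 <= n < 1 + 25)) /leb_to_nat.
  rewrite to_nat_pow9 N2Nat.inj_mul => /leq_trans; apply.
  rewrite multE; apply: leq_mul => //.
  rewrite to_nat_sumN -(big_mkord xpredT (ncodes false n.+1)).
  by apply: leq_sum => s _; have [] := hP n (ltac:(lia) : n < size h) s.
have [d dE] : exists d, d = N.to_nat den := ex_intro _ _ erefl.
have S := sub_solution_all dE sh hP st ta (ltac:(lia) : 18 < n).
(* [10000] is [den / 972], and the entries of [sub_p] add up to at least that. *)
have [k kE] : exists k, k = N.to_nat 10000 := ex_intro _ _ erefl.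
have denE : den = N.mul 972 10000 by [].
have dk : d = 972 * k by rewrite dE denE N2Nat.inj_mul -kE multE; congr muln.
have k0 : 0 < k by rewrite kE; apply: (@leb_to_nat 1 10000).
have kS : k <= \sum_(s < width) N.to_nat sub_p`[s].
  rewrite kE -(big_mkord xpredT (fun s => N.to_nat sub_p`[s])) -to_nat_sumN.
  by apply: leb_to_nat; vm_compute.
have le : 9 ^ n * \sum_(s < width) N.to_nat sub_p`[s] <= d * \sum_(s < width) ncodes false n s.
  by rewrite !big_distrr /=; apply: leq_sum => s _; have [] := S s.
rewrite -(leq_pmul2r k0) (leq_trans (leq_mul (leqnn _) kS)) // (leq_trans le) //.
by rewrite dk mulnAC.
Qed.

Local Open Scope ring_scope.
Import GRing.Theory Num.Theory.

Theorem theorem14 (n : nat) :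
  (1 / 12%:R) * 9%:R ^+ n <= (#|RR n|)%:R :> rat.
Proof.
have le : (9 ^ n <= 12 * #|RR n|)%N.
  (* There are [n + 2] vertices, and [972 = 12 * 9 ^ 2]. *)
  have := leq_trans (ncodes_lower (isT : (1 < n.+2)%N))
    (leq_mul (leqnn 972) (sum_ncodes_RR n width)).
  by rewrite !expnS; lia.
by rewrite mul1r mulrC ler_pdivrMr // mulrC -natrX -natrM ler_nat.
Qed.
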